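(* Let $m\in\mathbb N$. Suppose that $G$ is a digraph on $n:=3m$ vertices such that for every $x\in V(G)$, $d^+(x)\ge 2n/3$ or $d^-(x)\ge 2n/3$. Then $G$ contains a perfect $T_3$-packing.
   Context: A digraph has no loops and at most one edge in each direction between any two vertices; $d^+(x)$ and $d^-(x)$ denote the out- and indegree of $x$. $T_3$ denotes the transitive tournament on $3$ vertices. A $T_3$-packing is a collection of vertex-disjoint copies of $T_3$ in $G$ (not necessarily induced); it is perfect if it covers all vertices of $G$. *)

(* Defs.v *)
From mathcomp Require Import all_boot.
Set Implicit Arguments.
Unset Strict Implicit.
Unset Printing Implicit Defensive.

(* A digraph on a finite vertex type V is an irreflexive relation e : rel V,
   with e x y meaning that there is an edge from x to y; both e x y and e y x
   may hold. *)

Definition outdeg (V : finType) (e : rel V) (x : V) : nat := #|[set y | e x y]|.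

Definition indeg (V : finType) (e : rel V) (x : V) : nat := #|[set y | e y x]|.

Definition T3 : rel 'I_3 := fun i j => i < j.

(* T3 has no nontrivial automorphism, so a (not necessarily induced) copy of T3
   in e is the same thing as an injective homomorphism from T3 to e. *)
Definition T3_copy (V : finType) (e : rel V) (f : {ffun 'I_3 -> V}) : Prop :=
  injective f /\ (forall i j : 'I_3, T3 i j -> e (f i) (f j)).

Definition T3_packing (V : finType) (e : rel V)
    (P : {set {ffun 'I_3 -> V}}) : Prop :=
  (forall f, f \in P -> T3_copy e f) /\
  (forall f g, f \in P -> g \in P -> f != g -> [disjoint codom f & codom g]).

Definition perfect_T3_packing (V : finType) (e : rel V)
    (P : {set {ffun 'I_3 -> V}}) : Prop :=
  T3_packing e P /\ (forall x : V, exists2 f, f \in P & x \in codom f).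

(* Main.v *)
Require Import Defs.
From mathcomp Require Import all_boot all_order all_algebra zify.

(* Reversing edges at the vertices of large indegree, one may assume that every
   vertex has outdegree at least 2m.  The proof then follows Kierstead and
   Kostochka's proof of the Hajnal-Szemeredi theorem, by induction on m.

   Making the vertices adjacent to everything and undoing this one vertex at a
   time, we may assume that the vertices other than some x split into copies of
   T3 and a single edge E.  If a vertex y dominates a class X, then y can be
   moved into X, any vertex of X being released in exchange.  Let A be the set
   of classes from which a chain of moves leads to E, and let B be the set of
   the 3b + 1 vertices outside of these classes.  A vertex y of B dominates no
   class of A, so it has at least 2b + 1 outneighbours in B, and B - y has a
   perfect packing by induction.  It remains to absorb some y of B in the
   classes of A, or else to change the partition so that A grows.

   Let U be a class whose removal disconnects from E a nonempty set C of t
   classes, with t minimal: then no class of C disconnects another one.  If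
   w in W in C can move to a class of A - W and W - w + y is a T3 for some y in
   B, then y is absorbed.  Otherwise each W has at most one vertex z such that
   W - z + y is a T3 for some y in B, and t > b.  If y1 and y2 in B dominate
   W - z and y2 -> y1, then exchanging z and y1 makes the class of y2 reach E
   through W - z + y1.  If there is no such edge, a weighted count of the pairs
   (y, W) such that y has two outneighbours in W gives |B| t <= b t, which is
   absurd. *)

Set Implicit Arguments.
Unset Strict Implicit.
Unset Printing Implicit Defensive.

Import Order.TTheory GRing.Theory Num.Theory.

(* Give each pair [R i j] the weight [t / deg i], which is at most [b / deg j]. *)
Lemma double_count (I J : finType) (B : {set I}) (C : {set J}) (R : I -> J -> bool)
    (b t : nat) :
  (forall i, i \in B -> 0 < #|[set j in C | R i j]|) ->
  (forall i j, i \in B -> j \in C -> R i j ->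
     t * #|[set i' in B | R i' j]| <= b * #|[set j' in C | R i j']|) ->
  t * #|B| <= b * #|C|.
Proof.
move=> degI degIJ.
suff : (t%:R * #|B|%:R <= b%:R * #|C|%:R :> rat)%R by rewrite -!natrM ler_nat.
pose d i := #|[set j in C | R i j]|; pose d' j := #|[set i in B | R i j]|.
have const (K : finType) (P : pred K) (c : rat) :
    (\sum_(k | P k) c = c * #|[set k | P k]|%:R)%R.
  by rewrite mulr_natr -sumr_const; apply: eq_bigl => k; rewrite inE.
have -> : (t%:R * #|B|%:R =
    \sum_(i in B) \sum_(j in C | R i j) t%:R / (d i)%:R :> rat)%R.
  rewrite mulr_natr -sumr_const; apply: eq_bigr => i iB.
  by rewrite const divfK // pnatr_eq0 -lt0n; apply: degI.
apply: (@le_trans _ _ (\sum_(i in B) \sum_(j in C | R i j) b%:R / (d' j)%:R)%R).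
  apply: ler_sum => i iB; apply: ler_sum => j /andP[jC Rij].
  have d'_gt0 : 0 < d' j by apply/card_gt0P; exists i; rewrite inE iB.
  rewrite ler_pdivrMr ?ltr0n ?degI // mulrAC ler_pdivlMr ?ltr0n //.
  by rewrite -!natrM ler_nat degIJ.
rewrite (exchange_big_dep (mem C)) => [|i j _ /andP[]//] /=.
rewrite mulr_natr -sumr_const; apply: ler_sum => j jC.
rewrite (eq_bigl (fun i => (i \in B) && R i j)) => [|i]; last by rewrite jC.
rewrite const; have [->|d'_gt0] := posnP (d' j); first by rewrite invr0 mulr0 mul0r ler0n.
by rewrite divfK // pnatr_eq0 -lt0n.
Qed.

Lemma setUDK (T : finType) (A B : {set T}) : A \subset B -> A :|: (B :\: A) = B.
Proof. by move=> /setIidPr AB; rewrite -{1}AB setID. Qed.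

(** * Edges, copies of [T3] and packable sets *)

Section Digraph.

Variables (V : finType) (e : rel V).
Implicit Types (x y z : V) (S T W X : {set V}) (A Q : {set {set V}}).

Definition out x : {set V} := [set y | e x y].

Definition is_edge X :=
  [exists x, exists y, [&& X == [set x; y], x != y & e x y]].

Definition is_T3 T :=
  [exists x, exists y, exists z,
    [&& T == [set x; y; z], [&& x != y, x != z & y != z],
        e x y, e x z & e y z]].

Definition packable S :=
  exists2 P, partition P S & forall T, T \in P -> is_T3 T.

Lemma is_edgeP X :
  reflect (exists x y, [/\ X = [set x; y], x != y & e x y]) (is_edge X).
Proof.
apply: (iffP existsP) => [[x /existsP[y /and3P[/eqP-> xy exy]]]|[x [y [-> xy exy]]]].
  by exists x, y.
by exists x; apply/existsP; exists y; rewrite eqxx xy.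
Qed.

Lemma is_T3P T :
  reflect (exists x y z, [/\ T = [set x; y; z], [&& x != y, x != z & y != z],
                             e x y, e x z & e y z]) (is_T3 T).
Proof.
apply: (iffP existsP) => [[x /existsP[y /existsP[z /and5P[/eqP-> ? ? ? ?]]]]|].
  by exists x, y, z.
move=> [x [y [z [-> xyz exy exz eyz]]]].
exists x; apply/existsP; exists y; apply/existsP; exists z.
by rewrite eqxx xyz exy exz.
Qed.

Lemma card_edge X : is_edge X -> #|X| = 2.
Proof. by case/is_edgeP => x [y [-> xy _]]; rewrite cards2 xy. Qed.

Lemma card_T3 T : is_T3 T -> #|T| = 3.
Proof.
case/is_T3P => x [y [z [-> /and3P[xy xz yz] _ _ _]]].
by rewrite setUC cardsU1 cards2 !inE xy negb_or eq_sym xz eq_sym yz.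
Qed.

Lemma T3_edge T w : is_T3 T -> w \in T -> is_edge (T :\ w).
Proof.
case/is_T3P => x [y [z [-> /and3P[xy xz yz] exy exz eyz]]].
rewrite !inE -orbA => /or3P[] /eqP->; apply/is_edgeP.
- exists y, z; split=> //; apply/setP => t; rewrite !inE.
  by case: (eqVneq t x) => [->|//]; rewrite (negPf xy) (negPf xz).
- exists x, z; split=> //; apply/setP => t; rewrite !inE.
  by case: (eqVneq t y) => [->|]; rewrite ?orbF // eq_sym (negPf xy) (negPf yz).
- exists x, y; split=> //; apply/setP => t; rewrite !inE.
  by case: (eqVneq t z) => [->|]; rewrite ?orbF // ![z == _]eq_sym (negPf xz) (negPf yz).
Qed.

Hypothesis e_irr : irreflexive e.

Lemma out_neq x y : e x y -> x != y.
Proof. by apply: contraTneq => ->; rewrite e_irr. Qed.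

Lemma edge_dominated X y : is_edge X -> X \subset out y -> is_T3 (y |: X).
Proof.
case/is_edgeP => u [v [-> uv euv]]; rewrite subUset !sub1set !inE => /andP[yu yv].
apply/is_T3P; exists y, u, v; split=> //; last by rewrite !out_neq.
by rewrite setUA.
Qed.

Lemma edge_dominating X y :
  is_edge X -> (forall u, u \in X -> e u y) -> is_T3 (y |: X).
Proof.
case/is_edgeP => u [v [-> uv euv]] h.
have [uy vy] : e u y /\ e v y by split; apply: h; rewrite !inE eqxx ?orbT.
apply/is_T3P; exists u, v, y; split=> //; last by rewrite uv !out_neq.
by rewrite setUC.
Qed.

Lemma packable0 : packable set0.
Proof.
by exists set0 => [|T]; [rewrite partition_set0 | rewrite inE].
Qed.

Lemma T3_neq0 T : is_T3 T -> T != set0.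
Proof. by move/card_T3 => c; rewrite -card_gt0 c. Qed.

Lemma packableU1 T S :
  is_T3 T -> [disjoint T & S] -> packable S -> packable (T :|: S).
Proof.
move=> T3 dTS [P parP P3]; exists (T |: P); first exact: partitionU1 (T3_neq0 T3) dTS.
by move=> X; rewrite in_setU1 => /predU1P[->|/P3].
Qed.

Lemma partitionU (P Q : {set {set V}}) S T :
  partition P S -> partition Q T -> [disjoint S & T] ->
  partition (P :|: Q) (S :|: T).
Proof.
move=> /and3P[/eqP cP tP P0] /and3P[/eqP cQ tQ Q0] dST; apply/and3P; split.
- by rewrite /cover bigcup_setU -/(cover P) -/(cover Q) cP cQ.
- by apply: trivIsetU => //; rewrite cP cQ.
- by rewrite in_setU negb_or P0.
Qed.

Lemma packableU S T :
  packable S -> packable T -> [disjoint S & T] -> packable (S :|: T).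
Proof.
move=> [P pP P3] [Q pQ Q3] dST; exists (P :|: Q); first exact: partitionU.
by move=> X; rewrite in_setU => /orP[/P3|/Q3].
Qed.

(** * Near-packings and moves between their classes *)

Definition near_packing A E S :=
  [/\ partition A S, E \in A, is_edge E
    & forall T, T \in A -> T != E -> is_T3 T].

(** A move from [X] to [Y] by a vertex of [X]. Requiring both classes in [A] lets [step (A :\ U)]
    express the deletion of [U]. *)
Definition step A : rel {set V} := fun X Y =>
  [&& X \in A, Y \in A & [exists x in X, Y \subset out x]].

Lemma step_avoid A U X p :
  path (step A) X p -> U \notin X :: p -> path (step (A :\ U)) X p.
Proof.
elim: p X => //= Y p IH X /andP[/and3P[XA YA sXY] pY].
rewrite inE negb_or => /andP[UX Up].
rewrite IH // andbT /step !inE XA YA sXY !andbT eq_sym UX.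
by move: Up; rewrite inE negb_or eq_sym => /andP[].
Qed.

Lemma near_packingD1 A E S X : near_packing A E S -> X \in A -> X != E ->
  near_packing (A :\ X) E (S :\: X).
Proof.
move=> [pA EA E2 A3] XA XE; split=> //; first exact: partitionD1.
  by rewrite !inE eq_sym XE.
by move=> T; rewrite !inE => /andP[TX TA]; apply: A3.
Qed.

Lemma absorb_edge A E S y : near_packing A E S -> y \notin S ->
  is_T3 (y |: E) -> packable (y |: S).
Proof.
move=> [pA EA E2 A3] yS yE3.
have -> : y |: S = (y |: E) :|: (S :\: E).
  by rewrite -setUA setUDK // (partitionS pA).
apply: packableU1 => //.
  rewrite disjoint_sym disjoints_subset; apply/subsetP => t.
  rewrite !inE negb_or => /andP[tE tS]; rewrite tE andbT.
  by apply: contraNneq yS => <-.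
exists (A :\ E); first exact: partitionD1.
by move=> T; rewrite !inE => /andP[TE TA]; apply: A3.
Qed.

Lemma absorb_class A E S X x y : near_packing A E S -> x \notin S -> X \in A ->
  y \in X -> is_T3 (x |: X :\ y) -> packable (y |: (S :\: X)) ->
  packable (x |: S).
Proof.
move=> [pA _ _ _] xS XA yX x3 pk.
have sXS := partitionS pA XA.
have -> : x |: S = (x |: X :\ y) :|: (y |: (S :\: X)).
  rewrite -setUA; congr (_ :|: _); rewrite setUA [(_ :\ y) :|: _]setUC setD1K //.
  by rewrite setUDK.
apply: packableU1 => //.
rewrite disjoints_subset; apply/subsetP => t; rewrite !inE.
case/predU1P => [->|/andP[ty ->]]; last by rewrite negb_or ty.
rewrite negb_or (negPf xS) andbF andbT.
by apply: contraNneq xS => ->; apply: (subsetP sXS).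
Qed.

(** [x] enters [X] and releases the vertex that moves on to the next class, and so forth until [E]
    receives its third vertex. The chain is first made simple, so that the remaining moves survive
    the removal of [X]. *)
Lemma shift A E S x X : near_packing A E S -> x \notin S -> X \in A ->
  X \subset out x -> connect (step A) X E -> packable (x |: S).
Proof.
move=> nA xS XA dX /connectP[p0 pp0 Ep0].
case/shortenP: pp0 Ep0 => p pp up _ Ep {p0}.
elim: p A S x X nA xS XA dX pp up Ep => [|Y p IH] A S x X nA xS XA dX.
  move=> _ _ /= EX; rewrite -EX in XA dX; have [_ _ E2 _] := nA.
  by apply: (absorb_edge nA) => //; apply: edge_dominated.
move=> pp up /= Ep.
have XE : X != E.
  by move: up => /= /andP[Xp _]; apply: contraNneq Xp => ->; rewrite Ep mem_last.
have pp' : path (step (A :\ X)) Y p.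
  have /= /andP[_ pY] := pp; apply: step_avoid => //.
  by move: up => /= /andP[].
have /= /andP[/and3P[_ YA /existsP[y /andP[yX Yy]]] _] := pp.
have [pA _ _ /(_ X XA XE) X3] := nA.
apply: (absorb_class nA xS XA yX).
  apply: edge_dominated; first exact: T3_edge.
  by apply: subset_trans dX; apply: subsetDl.
apply: (IH (A :\ X) _ _ Y) => //.
- exact: near_packingD1.
- by rewrite !inE yX.
- move: up => /= /andP[XYp _]; rewrite !inE YA andbT eq_sym.
  by apply: contraNneq XYp => ->; rewrite inE eqxx.
- by case/andP: up.
Qed.

Definition accessible A E := [set X in A | connect (step A) X E].

(** Every class on a chain to [E] is itself accessible. *)
Lemma connect_accessible A E X : E \in A ->
  X \in accessible A E -> connect (step (accessible A E)) X E.
Proof.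
move=> EA; rewrite inE => /andP[XA /connectP[p]].
elim: p X XA => [|Y p IH] X XA /=; first by move=> _ ->.
move=> /andP[sXY pY] Ep.
have /and3P[_ YA sXY'] := sXY.
have cY : connect (step A) Y E by apply/connectP; exists p.
apply: connect_trans (IH Y YA pY Ep); apply: connect1.
by rewrite /step sXY' !inE XA YA cY (connect_trans (connect1 sXY) cY).
Qed.

(** * Counting outneighbours class by class *)

Lemma card_out_partition A S y :
  partition A S -> #|out y :&: S| = \sum_(X in A) #|out y :&: X|.
Proof.
move=> pA; have cE X : #|out y :&: X| = \sum_(x in X) (x \in out y).
  rewrite -sum1_card big_mkcond [RHS]big_mkcond; apply: eq_bigr => x _.
  by rewrite in_setI; do 2!case: (x \in _).
by rewrite cE (set_partition_big _ pA); apply: eq_bigr => X _; rewrite cE.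
Qed.

(** Adding the Boolean [X == E] as a number makes all classes count 3; it is the source of the [+ 1]
    in the counts below. *)
Lemma card_class A E S X :
  near_packing A E S -> X \in A -> #|X| + (X == E) = 3.
Proof.
case=> [_ _ E2 A3] XA; have [->|XE] := eqVneq X E; first by rewrite card_edge.
by rewrite card_T3 //; apply: A3.
Qed.

Lemma sum_eqE (A : {set {set V}}) E : E \in A -> \sum_(X in A) (X == E) = 1.
Proof.
move=> EA; rewrite (bigD1 E) //= eqxx big1 // => X /andP[_ /negPf->] //.
Qed.

Lemma card_near_packing A E S : near_packing A E S -> #|S| + 1 = 3 * #|A|.
Proof.
move=> nA; have [pA EA _ _] := nA.
rewrite (card_partition pA) -[X in _ + X](sum_eqE EA) -big_split /=.
rewrite (eq_bigr (fun=> 3)) => [|X XA]; last exact: card_class nA XA.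
by rewrite sum_nat_const mulnC.
Qed.

(** [c X] bounds the excess over two outneighbours in [X], or over one if [X] is [E]. *)
Lemma out_near_packing A E S y (c : {set V} -> nat) : near_packing A E S ->
  (forall X, X \in A -> #|out y :&: X| + (X == E) <= 2 + c X) ->
  #|out y :&: S| + 1 <= 2 * #|A| + \sum_(X in A) c X.
Proof.
move=> [pA EA _ _] h; rewrite (card_out_partition _ pA) -[X in _ + X <= _](sum_eqE EA).
by rewrite mulnC -sum_nat_const -!big_split /=; apply: leq_sum => X /h.
Qed.

Lemma nondominated_class A E S y X : near_packing A E S -> X \in A ->
  ~~ (X \subset out y) -> #|out y :&: X| + (X == E) <= 2.
Proof.
move=> nA XA nX; have := card_class nA XA.
have : #|out y :&: X| < #|X|.
  apply: proper_card; rewrite properE subsetIr.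
  by apply: contra nX; rewrite subsetI => /andP[].
lia.
Qed.

Lemma out_nondominating A E S y : near_packing A E S ->
  (forall X, X \in A -> ~~ (X \subset out y)) -> #|out y :&: S| + 1 <= 2 * #|A|.
Proof.
move=> nA h; have -> : 2 * #|A| = 2 * #|A| + \sum_(X in A) 0 by rewrite big1 ?addn0.
apply: (out_near_packing (c := fun=> 0) nA) => X XA; rewrite addn0.
exact: nondominated_class nA XA (h X XA).
Qed.

(** * Cuts in the graph of moves *)

Definition cut A E U :=
  [set W in A | (W != U) && ~~ connect (step (A :\ U)) W E].

Lemma cut_neq A E U W : W \in cut A E U -> W != E.
Proof. by rewrite inE => /and3P[_ _]; apply: contraNneq => ->. Qed.

(** No move enters [E] once it is deleted. This supplies a nonempty cut as soon as [A] has a second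
    class. *)
Lemma cutE_full A E : cut A E E = A :\ E.
Proof.
apply/setP => X; rewrite !inE; have [//|XE] := eqVneq X E; first by rewrite andbF.
rewrite /= andbC; case XA: (X \in A); rewrite ?andbF // !andbT.
apply/negP => /connectP[p pp Ep]; case/lastP: p pp Ep => [_ /= EX|p Y].
  by rewrite EX eqxx in XE.
by rewrite rcons_path last_rcons => /andP[_ /and3P[_ + _]] EY; rewrite -EY !inE eqxx.
Qed.

(** Every chain from [W] to [E] passes through [U], so a chain to [E] that avoids [U] also avoids
    [W]. Moreover [U] reaches [E] by a simple chain, which never returns to [U] and hence avoids
    [W]. *)
Lemma cut_subset A E U W : U \in A -> (forall X, X \in A -> connect (step A) X E) ->
  W \in cut A E U -> cut A E W \subset cut A E U :\ W.
Proof.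
move=> UA cA; rewrite inE => /and3P[WA WU nW].
have avoid X : connect (step (A :\ U)) X E -> connect (step (A :\ W)) X E.
  case/connectP => p; elim: p X => [|Y p IH] X /=; first by move=> _ ->.
  move=> /andP[sXY pY] Ep.
  have cY : connect (step (A :\ U)) Y E by apply/connectP; exists p.
  have cX := connect_trans (connect1 sXY) cY.
  apply: connect_trans (IH Y pY Ep); apply: connect1.
  have /and3P[] := sXY; rewrite !inE => /andP[_ XA] /andP[_ YA] dXY.
  rewrite /step !inE XA YA dXY !andbT.
  by apply/andP; split; apply: contraNneq nW => <-.
have cU : connect (step (A :\ W)) U E.
  have /connectP[p0 pp0 Ep0] := cA U UA.
  case/shortenP: pp0 Ep0 => [[|Y p]] pp up _ Ep {p0}; first by rewrite Ep connect0.
  have /= /andP[/and3P[_ YA sUY] pY] := pp.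
  have /= /andP[Up _] := up.
  have cY : connect (step (A :\ U)) Y E.
    by apply/connectP; exists p => //; apply: step_avoid.
  apply: connect_trans (avoid Y cY); apply: connect1.
  rewrite /step !inE UA YA sUY !andbT eq_sym WU.
  by apply: contraNneq nW => <-.
apply/subsetP => X; rewrite !inE => /and3P[XA XW nX]; rewrite XA XW /=.
apply/andP; split; first by apply: contraNneq nX => ->.
by apply: contra nX => /avoid.
Qed.

(** Choose a nonempty cut of minimum size: by [cut_subset], a nonempty cut by one of its members
    would be smaller, since it misses that member. *)
Lemma terminal_cut A E : E \in A -> 1 < #|A| ->
  (forall X, X \in A -> connect (step A) X E) ->
  exists U, [/\ U \in A, cut A E U != set0
    & forall W, W \in cut A E U -> cut A E W = set0].
Proof.
move=> EA A1 cA; pose P U := (U \in A) && (cut A E U != set0).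
have PE : P E.
  by rewrite /P EA cutE_full -card_gt0; move: A1; rewrite (cardsD1 E A) EA.
case: (arg_minnP (fun U => #|cut A E U|) PE) => U /andP[UA cU] min.
exists U; split=> // W Wc; apply/eqP; apply: contraT => cW.
have WA : W \in A by move: Wc; rewrite inE => /andP[].
have := min W; rewrite /P WA cW => /(_ isT).
have := subset_leq_card (cut_subset UA cA Wc).
have := cardsD1 W (cut A E U); rewrite Wc.
by move=> -> le1 /leq_trans/(_ le1); rewrite /= add1n ltnn.
Qed.

(** Otherwise [w] would start a chain from [W] through [X] to [E] that avoids [U]. *)
Lemma cut_next A E U W w X : U \in A -> W \in cut A E U -> w \in W ->
  X \in A -> X \subset out w -> X \in cut A E U \/ X = U.
Proof.
move=> UA; rewrite inE => /and3P[WA WU nW] wW XA dX.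
have [->|XU] := eqVneq X U; [by right|left].
rewrite inE XA XU /=; apply: contra nW; apply: connect_trans.
apply: connect1; rewrite /step !inE WU WA XU XA /=.
by apply/existsP; exists w; rewrite wW.
Qed.

Lemma common_out (B X Y : {set V}) :
  #|B| < #|X :&: B| + #|Y :&: B| -> exists y, [/\ y \in B, y \in X & y \in Y].
Proof.
rewrite -cardsUI => lt; have : 0 < #|(X :&: B) :&: (Y :&: B)|.
  have : #|X :&: B :|: Y :&: B| <= #|B| by rewrite subset_leq_card // subUset !subsetIr.
  lia.
by case/card_gt0P => y; rewrite !inE => /andP[/andP[yX yB] /andP[yY _]]; exists y.
Qed.

Lemma sum_mem (A D : {set {set V}}) : D \subset A -> \sum_(X in A) (X \in D) = #|D|.
Proof.
move=> /setIidPr sDA; rewrite -sum1_card big_mkcond [RHS]big_mkcond.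
by apply: eq_bigr => X _; rewrite -{2}sDA inE; do 2!case: (X \in _).
Qed.

(** * Absorbing a vertex or finding a swap *)

Section KeyStep.

Variables (A : {set {set V}}) (E S B : {set V}) (b : nat).
Hypotheses (nA : near_packing A E S) (dSB : [disjoint S & B])
  (cardB : #|B| = 3 * b + 1)
  (cA : forall X, X \in A -> connect (step A) X E)
  (ndB : forall y X, y \in B -> X \in A -> ~~ (X \subset out y))
  (degSB : forall y, y \in S :|: B -> 2 * (#|A| + b) <= #|out y :&: (S :|: B)|)
  (pkB : forall y, y \in B -> packable (B :\ y)).

Let EA : E \in A. Proof. by case: nA. Qed.
Let pA : partition A S. Proof. by case: nA. Qed.

Let degSplit y : y \in S :|: B ->
  2 * (#|A| + b) <= #|out y :&: S| + #|out y :&: B|.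
Proof.
move=> /degSB /leq_trans; apply; rewrite setIUr.
exact: (leq_card_setU _ _).1.
Qed.

Let class_sub X x : X \in A -> x \in X -> x \in S.
Proof. by move=> XA; apply: subsetP; apply: partitionS pA XA. Qed.

Let BnotS y : y \in B -> y \notin S.
Proof. by move=> yB; rewrite (disjointFl dSB yB). Qed.

(** At most [2 * #|A| - 1] outneighbours lie in [S]: two per class, and only one in [E]. *)
Lemma degB_nondominating y : y \in S :|: B ->
  (forall X, X \in A -> ~~ (X \subset out y)) -> 2 * b + 1 <= #|out y :&: B|.
Proof.
by move=> /degSplit deg /(out_nondominating nA); move: deg; clear; lia.
Qed.

Lemma absorbed y : y \in B -> packable (y |: S) -> packable (S :|: B).
Proof.
move=> yB pk; have -> : S :|: B = (y |: S) :|: (B :\ y).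
  by rewrite [y |: S]setUC -setUA setD1K.
apply: packableU => //; first exact: pkB.
rewrite disjoint_sym disjoints_subset; apply/subsetP => t; rewrite !inE.
by case/andP => ty tB; rewrite negb_or ty BnotS.
Qed.

Lemma packable_single : #|A| <= 1 -> packable (S :|: B).
Proof.
move=> A1; have [_ _ E2 _] := nA.
have AE X : X \in A -> X = E by move/card_le1_eqP: A1 => h XA; apply: h.
have degE u : u \in E -> 2 * b + 1 <= #|out u :&: B|.
  move=> uE; apply: degB_nondominating; first by rewrite inE (class_sub EA).
  by move=> X /AE->; apply/subsetPn; exists u; rewrite ?inE ?e_irr.
have /is_edgeP[u [v [EE uv euv]]] := E2.
(* Two sets of at least [2 * b + 1] vertices of [B] meet, as [B] has only [3 * b + 1]. *)
have [y [yB]] : exists y, [/\ y \in B, y \in out u & y \in out v].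
  apply: common_out; have := degE u; have := degE v.
  by rewrite EE !inE !eqxx orbT => /(_ isT) ? /(_ isT) ?; lia.
rewrite !inE => uy vy; apply: (absorbed yB); apply: (absorb_edge nA); first exact: BnotS.
by apply: edge_dominating => // w; rewrite EE !inE => /orP[] /eqP->.
Qed.

(** * Mobile and solo vertices of the classes cut off by [U] *)

Variables (U : {set V}).
Hypotheses (UA : U \in A) (C_neq0 : cut A E U != set0)
  (minU : forall W, W \in cut A E U -> cut A E W = set0).
Let C := cut A E U.

Definition mobile W w := [exists X in A :\ W, X \subset out w].
Definition solo W z := [exists y in B, is_T3 (y |: W :\ z)].

Let CA W : W \in C -> W \in A.
Proof. by rewrite inE => /andP[]. Qed.

Let C3 W : W \in C -> is_T3 W.
Proof. by move=> WC; have [_ _ _] := nA; apply; [apply: CA|apply: cut_neq WC]. Qed.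

Lemma terminal W X : W \in C -> X \in A :\ W -> connect (step (A :\ W)) X E.
Proof.
move=> WC; rewrite inE in_set1 => /andP[XW XA]; apply: contraT => nX.
by have := in_set0 X; rewrite -(minU WC) inE XA XW nX.
Qed.

(** Take the first move of a simple chain from [W] to [E]. *)
Lemma exists_mobile W : W \in C -> exists2 w, w \in W & mobile W w.
Proof.
move=> WC; have /connectP[p0 pp0 Ep0] := cA (CA WC).
case/shortenP: pp0 Ep0 => [[|X p]] pp up _ Ep {p0}.
  by have := cut_neq WC; rewrite Ep eqxx.
have /= /andP[/and3P[_ XA /existsP[w /andP[wW dX]]] _] := pp.
exists w => //; apply/existsP; exists X; rewrite !inE XA dX !andbT.
by have /= /andP[] := up; rewrite inE negb_or eq_sym => /andP[].
Qed.

(** [w] gives its place to [y] and is pushed from [X] to [E] through classes other than [W], which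
    [terminal] makes possible. *)
Lemma packable_mobile_solo W w : W \in C -> w \in W -> mobile W w -> solo W w ->
  packable (S :|: B).
Proof.
move=> WC wW /existsP[X /andP[XAW dX]] /existsP[y /andP[yB y3]].
have WE : W != E := cut_neq WC.
apply: (absorbed yB); apply: (absorb_class nA (BnotS yB) (CA WC) wW y3).
apply: (shift (near_packingD1 nA (CA WC) WE) _ XAW dX); last exact: terminal.
by rewrite !inE wW.
Qed.

Hypothesis nsolo : forall W w, W \in C -> w \in W -> mobile W w -> ~~ solo W w.

(** A solo vertex is not mobile, so it dominates no other class; having no loop, it does not
    dominate [W] either. *)
Lemma degB_solo W z : W \in C -> z \in W -> solo W z -> 2 * b + 1 <= #|out z :&: B|.
Proof.
move=> WC zW sz; apply: degB_nondominating.
  by rewrite inE (class_sub (CA WC)).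
move=> X XA; apply/negP => dX; have [XW|XW] := eqVneq X W.
  by have := subsetP dX z; rewrite XW inE e_irr => /(_ zW).
suff mz : mobile W z by have := nsolo WC zW mz; rewrite sz.
by apply/existsP; exists X; rewrite !inE XW XA.
Qed.

(* Apart from those of [C :\ W], only the class [U] can be dominated by [w]. *)
Lemma degB_cut W w : W \in C -> w \in W -> 2 * b + 1 <= #|out w :&: B| + #|C|.
Proof.
move=> WC wW.
have /degSplit deg : w \in S :|: B by rewrite inE (class_sub (CA WC)).
suff : #|out w :&: S| + 1 <= 2 * #|A| + \sum_(X in A) ((X \in C :\ W) + (X == U)).
  have CW : C :\ W \subset A by apply/subsetP => X; rewrite inE => /andP[_ /CA].
  rewrite big_split /= sum_eqE // sum_mem //.
  rewrite (cardsD1 W C) WC /=; move: deg; set a := #|A|; set k := #|C :\ W|; clear; lia.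
apply: (out_near_packing (c := fun X => (X \in C :\ W) + (X == U)) nA) => X XA.
have [dX|ndX] := boolP (X \subset out w); last first.
  exact: leq_trans (nondominated_class nA XA ndX) (leq_addr _ _).
have XW : X != W.
  by apply: contraTneq dX => ->; apply/subsetPn; exists w; rewrite ?inE ?e_irr.
apply: (@leq_trans 3).
  by rewrite -(card_class nA XA) leq_add2r subset_leq_card ?subsetIr.
rewrite (leq_add2l 2 1); have [XC|->] := cut_next UA WC wW XA dX.
  by rewrite in_setD1 XW XC.
by rewrite eqxx addn1.
Qed.

Lemma solo_of_dominating W w y : W \in C -> w \in W -> y \in B ->
  (forall v, v \in W :\ w -> e v y) -> solo W w.
Proof.
move=> WC wW yB dy; apply/existsP; exists y; rewrite yB /=.
by apply: edge_dominating => //; apply: T3_edge => //; apply: C3.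
Qed.

(** A mobile [w] is not solo, so the other two vertices [u] and [v] of [W] share no outneighbour in
    [B]. This limits their outdegrees into [B], which [degB_cut] makes large unless [C] is large. *)
Lemma card_gt_cut W : W \in C -> b + 1 <= #|C|.
Proof.
move=> WC; have [w wW mw] := exists_mobile WC.
have /negP nsw := nsolo WC wW mw.
have nsolo2 u v y : W :\ w = [set u; v] -> y \in B -> e u y -> e v y -> solo W w.
  move=> E2 yB uy vy; apply: (solo_of_dominating WC wW yB) => x.
  by rewrite E2 !inE => /orP[] /eqP->.
have /is_edgeP[u [v [E2 uv _]]] := T3_edge (C3 WC) wW.
have uW : u \in W by have := setU11 u [set v]; rewrite -E2 !inE => /andP[].
have vW : v \in W by have := set22 u v; rewrite -E2 !inE => /andP[].
have disj2 : #|out u :&: B| + #|out v :&: B| <= #|B|.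
  rewrite leqNgt; apply/negP => /common_out[y [yB]]; rewrite !inE => uy vy.
  exact: nsw (nsolo2 u v y E2 yB uy vy).
have du := degB_cut WC uW; have dv := degB_cut WC vW; have dw := degB_cut WC wW.
(* With [u] solo, [v] has at most [b] outneighbours in [B], and [degB_cut] for [v] concludes. *)
have [su|nsu] := boolP (solo W u).
  by have := degB_solo WC uW su; move: du dv disj2; rewrite cardB; clear; lia.
have [sv|nsv] := boolP (solo W v).
  by have := degB_solo WC vW sv; move: du dv disj2; rewrite cardB; clear; lia.
(* With no solo vertex in [W], the three outneighbourhoods in [B] are pairwise disjoint, so
   [3 * (2 * b + 1 - #|C|) <= 3 * b + 1]. *)
have third x x' : W :\ w = [set x; x'] -> x' \in W -> x != x' -> ~~ solo W x' ->
    [disjoint out w :&: B & out x :&: B].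
  move=> E2' x'W xx' nsx'; rewrite -setI_eq0; apply/eqP/setP => y; rewrite !inE.
  apply/negP => /andP[/andP[wy yB] /andP[xy _]]; case/negP: nsx'.
  apply: (solo_of_dominating WC x'W yB) => // a; rewrite !inE => /andP[ax' aW].
  have [->//|aw] := eqVneq a w.
  have : a \in W :\ w by rewrite !inE aw.
  by rewrite E2' !inE (negPf ax') orbF => /eqP->.
have dwu := third u v E2 vW uv nsv.
have dwv : [disjoint out w :&: B & out v :&: B].
  by apply: (third v u) => //; rewrite 1?setUC // eq_sym.
have : #|out w :&: B| + #|(out u :&: B) :|: (out v :&: B)| <= #|B|.
  rewrite -cardsUI; have -> : (out w :&: B) :&: (out u :&: B :|: out v :&: B) = set0.
    by rewrite setIUr (disjoint_setI0 dwu) (disjoint_setI0 dwv) setU0.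
  by rewrite cards0 addn0 subset_leq_card // !subUset !subsetIr.
have -> : #|out u :&: B :|: out v :&: B| = #|out u :&: B| + #|out v :&: B|.
  rewrite -cardsUI; have -> : (out u :&: B) :&: (out v :&: B) = set0.
    apply/setP => y; rewrite !inE; apply/negP => /andP[/andP[uy yB] /andP[vy _]].
    exact: nsw (nsolo2 u v y E2 yB uy vy).
  by rewrite cards0 addn0.
by move: du dv dw; rewrite cardB; clear; lia.
Qed.

(** Two distinct solo vertices would be the two vertices of [W] other than a mobile [w]. By
    [degB_solo] they have a common outneighbour in [B], which would make [w] solo. *)
Lemma solo_unique W z1 z2 : W \in C -> z1 \in W -> z2 \in W ->
  solo W z1 -> solo W z2 -> z1 = z2.
Proof.
move=> WC z1W z2W s1 s2; apply/eqP; apply: contraT => z12.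
have [w wW mw] := exists_mobile WC.
have /negP nsw := nsolo WC wW mw.
have wz z : solo W z -> z != w by move=> sz; apply/eqP => zw; apply: nsw; rewrite -zw.
have EW : W :\ w = [set z1; z2].
  apply/eqP; rewrite eq_sym eqEcard cards2 z12 subUset !sub1set !inE z1W z2W.
  by rewrite (wz _ s1) (wz _ s2) (card_edge (T3_edge (C3 WC) wW)).
have [y [yB]] : exists y, [/\ y \in B, y \in out z1 & y \in out z2].
  apply: common_out; have := degB_solo WC z1W s1; have := degB_solo WC z2W s2.
  by rewrite cardB; clear; lia.
rewrite !inE => e1 e2; case: nsw; apply: (solo_of_dominating WC wW yB) => // x.
by rewrite EW !inE => /orP[] /eqP->.
Qed.

Definition halved W := [set y in B | 1 < #|out y :&: W|].

(** [y] misses a vertex [z] of [W] but has two outneighbours there, so it dominates the edge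
    [W :\ z]. *)
Lemma halved_solo W y : W \in C -> y \in halved W ->
  exists z, [/\ z \in W, W :\ z \subset out y & is_T3 (y |: W :\ z)].
Proof.
move=> WC; rewrite inE => /andP[yB cy].
have /subsetPn[z zW zy] := ndB yB (CA WC).
have Wzy : W :\ z \subset out y.
  have /eqP <- : out y :&: W == W :\ z; last exact: subsetIl.
  rewrite eqEcard; apply/andP; split.
    apply/subsetP => x; rewrite !in_setI in_setD1 => /andP[xy ->]; rewrite andbT.
    by apply: contraNneq zy => <-.
  by rewrite (card_edge (T3_edge (C3 WC) zW)).
by exists z; split=> //; apply: edge_dominated => //; apply: T3_edge => //; apply: C3.
Qed.

(** [y] has at most two outneighbours in each class of [A], at most one in [E], and at most one in a
    class of [C] that it does not halve. *)
Lemma degB_halved y : y \in B ->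
  2 * b + 1 + #|C| <= #|out y :&: B| + #|[set W in C | y \in halved W]|.
Proof.
move=> yB; have /degSplit deg : y \in S :|: B by rewrite inE yB orbT.
suff : #|out y :&: S| + 1 + #|C| <= 2 * #|A| + #|[set W in C | y \in halved W]|.
  by move: deg; clear; lia.
have CsA : C \subset A by apply/subsetP => X /CA.
have HsA : [set W in C | y \in halved W] \subset A.
  by apply/subsetP => X; rewrite inE => /andP[/CA].
rewrite -(sum_mem CsA) -(sum_mem HsA) (card_out_partition _ pA).
rewrite -[X in _ + X + _](sum_eqE EA) mulnC -sum_nat_const -!big_split /=.
apply: leq_sum => X XA; rewrite [in leqRHS]inE.
have := nondominated_class nA XA (ndB yB XA).
have [XC|XC] := boolP (X \in C); last by rewrite !addn0.
have -> : (y \in halved X) = (1 < #|out y :&: X|) by rewrite inE yB.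
rewrite (negPf (cut_neq XC)) !addn0 /=.
by case: ltnP => [_ le2|le1 _]; rewrite addn1.
Qed.

Lemma halved_edge :
  exists W y1 y2, [/\ W \in C, y1 \in halved W, y2 \in halved W & e y2 y1].
Proof.
have [/existsP[W /andP[WC]]|] := boolP [exists W in C,
    [exists y1 in halved W, [exists y2 in halved W, e y2 y1]]].
  case/existsP => y1 /andP[h1 /existsP[y2 /andP[h2 e21]]].
  by exists W, y1, y2.
rewrite negb_exists => /forallP indep.
have /set0Pn[W0 W0C] := C_neq0; have gtC := card_gt_cut W0C.
have degF W y : W \in C -> y \in halved W -> #|out y :&: B| + #|halved W| <= #|B|.
  move=> WC hy; rewrite -cardsUI; have -> : (out y :&: B) :&: halved W = set0.
    apply/setP => x; rewrite !inE; apply/negP.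
    move=> /andP[/andP[yx xB] /andP[_ cx]]; have /negP := indep W; apply.
    rewrite WC; apply/existsP; exists x; rewrite inE xB cx.
    by apply/existsP; exists y; rewrite hy.
  rewrite cards0 addn0 subset_leq_card // subUset subsetIr.
  by apply/subsetP => x; rewrite inE => /andP[].
have : #|C| * #|B| <= b * #|C|.
  (* As [#|B| = 3 * b + 1] and [b < #|C|], [degB_halved] leaves every [y] at least one halved
     class. *)
  apply: (@double_count _ _ B C (fun y W => y \in halved W)) => [y yB|y W yB WC hy].
    have := degB_halved yB; have : #|out y :&: B| <= #|B| by rewrite subset_leq_card ?subsetIr.
    by rewrite cardB; move: gtC; clear; lia.
  have -> : [set y' in B | y' \in halved W] = halved W.
    by apply/setP => x; rewrite !inE; case: (x \in B).
  have := degB_halved yB; have := degF W y WC hy.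
  have : 2 * b + 1 <= #|out y :&: B|.
    apply: degB_nondominating => [|X]; last exact: ndB.
    by rewrite inE yB orbT.
  rewrite cardB; move: gtC; clear.
  move: #|out y :&: B| #|C| #|halved W| #|[set _ in _ | _]| => o t f d tb ob of1 od.
  have fb : f <= b by lia.
  (* Here [b * (t - b + f) - t * f = (t - b) * (b - f)], with both factors nonnegative. *)
  by have : t - b + f <= d; nia.
by rewrite cardB mulnC leq_pmul2r; move: gtC; clear; lia.
Qed.

(** Both vertices of [B] miss the same [z] because [W] has at most one solo vertex, so [y2]
    dominates all of [W] with [z] replaced by [y1]. A mobile vertex differs from [z], hence stays in
    the new class and lets it reach [E]. *)
Lemma swap : exists W z y1 y2,
  [/\ [/\ W \in A, W != E, z \in W & is_T3 (y1 |: W :\ z)],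
      [/\ y1 \in B, y2 \in B, e y2 y1 & W :\ z \subset out y2],
      exists2 w, w \in W :\ z & exists2 X, X \in A :\ W & X \subset out w
    & forall X, X \in A :\ W -> connect (step (A :\ W)) X E].
Proof.
have [W [y1 [y2 [WC h1 h2 e21]]]] := halved_edge.
have [y1B y2B] : y1 \in B /\ y2 \in B.
  by move: h1 h2; rewrite !inE => /andP[? _] /andP[].
have [z1 [z1W _ y1T]] := halved_solo WC h1.
have [z2 [z2W dy2 y2T]] := halved_solo WC h2.
have s1 : solo W z1 by apply/existsP; exists y1; rewrite y1B.
have s2 : solo W z2 by apply/existsP; exists y2; rewrite y2B.
have Ez := solo_unique WC z1W z2W s1 s2; rewrite -Ez in dy2.
exists W, z1, y1, y2; split.
- by split=> //; [apply: CA | apply: cut_neq WC].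
- by split.
- have [w wW mw] := exists_mobile WC; exists w.
    rewrite in_setD1 wW andbT; apply: contraTneq s1 => <-.
    exact: nsolo mw.
  by have /existsP[X /andP[XA dX]] := mw; exists X.
- by move=> X; apply: terminal.
Qed.

End KeyStep.

Lemma pack_or_swap (A : {set {set V}}) (E S B : {set V}) b :
  near_packing A E S -> [disjoint S & B] -> #|B| = 3 * b + 1 ->
  (forall X, X \in A -> connect (step A) X E) ->
  (forall y X, y \in B -> X \in A -> ~~ (X \subset out y)) ->
  (forall y, y \in S :|: B -> 2 * (#|A| + b) <= #|out y :&: (S :|: B)|) ->
  (forall y, y \in B -> packable (B :\ y)) ->
  packable (S :|: B) \/ exists W z y1 y2,
  [/\ [/\ W \in A, W != E, z \in W & is_T3 (y1 |: W :\ z)],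
      [/\ y1 \in B, y2 \in B, e y2 y1 & W :\ z \subset out y2],
      exists2 w, w \in W :\ z & exists2 X, X \in A :\ W & X \subset out w
    & forall X, X \in A :\ W -> connect (step (A :\ W)) X E].
Proof.
move=> nA dSB cardB cA ndB degSB pkB; have [_ EA _ _] := nA.
have [A1|A1] := leqP #|A| 1; first by left; apply: (packable_single nA dSB cardB degSB pkB A1).
have [U [UA C0 minU]] := terminal_cut EA A1 cA.
have [/existsP[W /andP[WC /existsP[w /and3P[wW mw sw]]]]|nex] := boolP
    [exists W in cut A E U, [exists w, [&& w \in W, mobile A W w & solo B W w]]].
  by left; apply: (packable_mobile_solo nA dSB pkB minU WC wW mw sw).
right; apply: (swap nA cardB cA ndB degSB UA C0 minU) => W w WC wW mw.
apply: contra nex => sw; apply/existsP; exists W; rewrite WC /=.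
by apply/existsP; exists w; apply/and3P.
Qed.

(** * Growth of the set of accessible classes *)

Lemma near_packing_sub A Q E S : near_packing Q E S -> A \subset Q -> E \in A ->
  near_packing A E (cover A).
Proof.
move=> [/and3P[_ tQ Q0] _ E2 Q3] sAQ EA; split=> //.
  rewrite /partition eqxx (trivIsetS sAQ tQ) /=.
  by apply: contra Q0; apply: (subsetP sAQ).
by move=> T /(subsetP sAQ); apply: Q3.
Qed.

(** A swap replaces [W] by [W'] among the accessible classes and repacks [B :\ y1] by induction. The
    class that then contains [y2] becomes accessible as well, and [z] becomes the uncovered
    vertex. *)
Lemma pack_or_extend m (D : {set V}) Q E x :
  (forall k (S : {set V}), k < m -> #|S| = 3 * k ->
     (forall y, y \in S -> 2 * k <= #|out y :&: S|) -> packable S) ->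
  #|D| = 3 * m -> (forall y, y \in D -> 2 * m <= #|out y :&: D|) ->
  x \in D -> near_packing Q E (D :\ x) ->
  packable D \/ exists Q' z, [/\ z \in D, near_packing Q' E (D :\ z)
    & #|accessible Q E| < #|accessible Q' E|].
Proof.
move=> IH cD degD xD nQ; have [pQ EQ E2 Q3] := nQ.
set A := accessible Q E; pose S := cover A; pose B := D :\: S.
have AQ : A \subset Q by apply/subsetP => X; rewrite inE => /andP[].
have EA : E \in A by rewrite inE EQ connect0.
have nA : near_packing A E S := near_packing_sub nQ AQ EA.
have sSD : S \subset D :\ x.
  rewrite -(cover_partition pQ); apply/bigcupsP => X /(subsetP AQ) XQ.
  exact: bigcup_sup.
have sSD' : S \subset D := subset_trans sSD (subsetDl _ _).
have SB : S :|: B = D by apply: setUDK.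
have dSB : [disjoint S & B].
  by rewrite disjoint_sym disjoints_subset; apply/subsetP => t; rewrite !inE => /andP[].
have cS : #|S| + 1 = 3 * #|A| := card_near_packing nA.
have cSB : #|S| + #|B| = 3 * m.
  by rewrite -cD -SB; have /leqifP := leq_card_setU S B; rewrite dSB => /eqP.
have cSD : #|S| + 1 <= 3 * m.
  by have := subset_leq_card sSD; have := cardsD1 x D; rewrite xD cD /=; clear; lia.
(* No truncation occurs: [S] misses [x], so [3 * #|A| = #|S| + 1 <= 3 * m]. *)
pose b := m - #|A|.
have mE : m = #|A| + b by move: cS cSD; rewrite /b; clear; lia.
have cB : #|B| = 3 * b + 1 by move: cS cSB mE; clearbody b; clear; lia.
have A_gt0 : 0 < #|A| by apply/card_gt0P; exists E.
have cA X : X \in A -> connect (step A) X E by apply: connect_accessible.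
have [/existsP[X /andP[XA dX]]|nx] := boolP [exists X in A, X \subset out x].
  left; rewrite -(setD1K xD); apply: (shift nQ _ (subsetP AQ X XA) dX).
    by rewrite !inE eqxx.
  by move: XA; rewrite inE => /andP[].
have ndB y X : y \in B -> X \in A -> ~~ (X \subset out y).
  rewrite inE => /andP[yS yD] XA.
  (* [x] lies in no class of [Q] and is handled by [nx]; the class in [Q] of any other such [y]
     would already be accessible. *)
  have [->|yx] := eqVneq y x.
    by apply: contra nx => dX; apply/existsP; exists X; rewrite XA.
  apply: contra yS => dX.
  have : y \in cover Q by rewrite (cover_partition pQ) !inE yx.
  case/bigcupP => Y YQ yY; apply/bigcupP; exists Y => //; rewrite inE YQ /=.
  move: XA; rewrite inE => /andP[XQ]; apply: connect_trans; apply: connect1.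
  by rewrite /step YQ XQ; apply/existsP; exists y; rewrite yY.
have degSB y : y \in S :|: B -> 2 * (#|A| + b) <= #|out y :&: (S :|: B)|.
  by rewrite SB -mE; apply: degD.
(* Deleting [y] costs at most one of the [2 * b + 1] outneighbours in [B], and [b < m] since [A]
   contains [E]. *)
have pkB y : y \in B -> packable (B :\ y).
  move=> yB; apply: (IH b) => [||v]; first by move: mE A_gt0; clear; lia.
    by have := cardsD1 y B; rewrite yB cB /=; clear; lia.
  rewrite inE => /andP[_ vB].
  have := degB_nondominating nA degSB (_ : v \in S :|: B) (fun X => ndB v X vB).
  rewrite inE vB orbT => /(_ isT); rewrite setIDA; have := cardsD1 y (out v :&: B).
  by case: (y \in _); clear; lia.
have [|[W [z [y1 [y2 [[WA WE zW W3] [y1B y2B e21 dy2] [w wW [X XA dX]] tW]]]]]] :=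
  pack_or_swap nA dSB cB cA ndB degSB pkB; first by rewrite SB; left.
right; pose W' := y1 |: W :\ z.
have [P pP P3] := pkB y1 y1B.
have sWS : W \subset S by have [pA _ _ _] := nA; apply: partitionS pA WA.
have nS y : y \in B -> y \notin S by rewrite inE => /andP[].
have notA y (Y : {set V}) : y \in B -> y \in Y -> Y \notin A.
  by move=> /nS yS yY; apply: contra yS => YA; apply/bigcupP; exists Y.
have y21 : y2 != y1 := out_neq e21.
have pAW : partition (A :\ W) (S :\: W) by have [pA _ _ _] := nA; apply: partitionD1.
have dSBy : [disjoint S :\: W & B :\ y1].
  by apply: disjointW dSB; apply: subsetDl.
pose Q' := W' |: ((A :\ W) :|: P).
have dW' : [disjoint W' & (S :\: W) :|: (B :\ y1)].
  rewrite disjoints_subset; apply/subsetP => t; rewrite !inE.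
  case/predU1P => [->|/andP[tz tW']].
    by rewrite eqxx /= (negPf (nS _ y1B)) andbF.
  by rewrite tW' (subsetP sWS) //= !andbF.
have DE : D :\ z = W' :|: ((S :\: W) :|: (B :\ y1)).
  apply/setP => t; rewrite !inE.
  have zS : z \in S := subsetP sWS z zW.
  have [->|ty1] := eqVneq t y1.
    have y1D : y1 \in D by rewrite -SB inE y1B orbT.
    by rewrite y1D andbT /=; apply: contraNneq (nS _ y1B) => ->.
  have [->|tz] /= := eqVneq t z; first by rewrite zW zS.
  have [tW'|tW'] /= := boolP (t \in W); first by rewrite (subsetP sSD') ?(subsetP sWS).
  by case tS : (t \in S); rewrite //= (subsetP sSD').
have pQ' : partition Q' (D :\ z).
  rewrite DE; apply: partitionU1 (T3_neq0 W3) dW'; exact: partitionU.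
exists Q', z; split.
- by rewrite (subsetP sSD') ?(subsetP sWS).
- split=> //; first by rewrite in_setU1 in_setU in_setD1 EA (eq_sym E W) WE orbT.
  move=> T; rewrite in_setU1 in_setU in_setD1 => /predU1P[-> //|/orP[/andP[_ TA]|/P3//]].
  by have [_ _ _] := nA; apply.
have subQ' : subrel (connect (step (A :\ W))) (connect (step Q')).
  apply: connect_sub => Y Z /and3P[YA ZA dYZ]; apply: connect1.
  by rewrite /step !inE dYZ andbT; move: YA ZA; rewrite !inE => -> ->; rewrite !orbT.
have AWQ' : A :\ W \subset accessible Q' E.
  apply/subsetP => Y YA; rewrite inE (subQ' _ _ (tW Y YA)) andbT.
  by rewrite inE [Y \in _ :|: P]inE YA orbT.
have W'Q' : W' \in accessible Q' E.
  have := subsetP AWQ' X XA; rewrite inE => /andP[XQ' cX].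
  rewrite inE setU11; apply: connect_trans cX; apply: connect1.
  rewrite /step setU11 XQ'; apply/existsP; exists w.
  by rewrite dX andbT in_setU1 wW orbT.
have : y2 \in cover P by rewrite (cover_partition pP) in_setD1 y21.
case/bigcupP => Y YP y2Y.
have YQ' : Y \in accessible Q' E.
  have YQ' : Y \in Q' by rewrite in_setU1 in_setU YP !orbT.
  have := W'Q'; rewrite inE => /andP[W'Q'' cW'].
  rewrite inE YQ'; apply: connect_trans cW'; apply: connect1.
  rewrite /step W'Q'' YQ'; apply/existsP; exists y2.
  by rewrite y2Y subUset sub1set inE e21.
(* [W'] and [Y] contain vertices of [B], so neither is an old class; only [W] is lost. *)
have sub : Y |: (W' |: A :\ W) \subset accessible Q' E.
  by rewrite !subUset !sub1set YQ' W'Q'.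
apply: leq_trans (subset_leq_card sub); rewrite !cardsU1.
have y1W' : y1 \in W' by apply: setU11.
have YW' : Y != W'.
  apply: contraTneq y2Y => ->; rewrite in_setU1 (negPf y21) in_setD1 negb_and.
  by rewrite orbC (contra (subsetP sWS y2)) ?nS.
rewrite in_setU1 negb_or YW' !in_setD1 (negPf (notA y2 Y y2B y2Y)).
rewrite (negPf (notA y1 W' y1B y1W')) !andbF /=.
by rewrite (cardsD1 W A) WA.
Qed.

(** Every swap enlarges the set of accessible classes, whose size is bounded by the number of sets
    of vertices. *)
Lemma pack_of_near_packing m (D : {set V}) Q E x :
  (forall k (S : {set V}), k < m -> #|S| = 3 * k ->
     (forall y, y \in S -> 2 * k <= #|out y :&: S|) -> packable S) ->
  #|D| = 3 * m -> (forall y, y \in D -> 2 * m <= #|out y :&: D|) ->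
  x \in D -> near_packing Q E (D :\ x) -> packable D.
Proof.
move=> IH cD degD.
have [N maxN] : exists N, forall Q, #|accessible Q E| <= N.
  by exists #|{: {set V}}| => Q'; apply: max_card.
have [n le_n] : exists n, N - #|accessible Q E| <= n by eexists.
elim: n Q x le_n => [|n IHn] Q x le_n xD nQ;
  have [//|[Q' [z [zD nQ' ltQ]]]] := pack_or_extend IH cD degD xD nQ.
  by have := maxN Q'; move: le_n ltQ; clear; lia.
by apply: (IHn Q' z) => //; have := maxN Q'; move: le_n ltQ; clear; lia.
Qed.

End Digraph.

(** * Existence of a near-packing *)

Section Transfer.

Variables (V : finType) (e e' : rel V) (X : {set V}).
Hypothesis ee' : forall x y, x \in X -> y \in X -> e x y -> e' x y.

Lemma is_edge_sub : is_edge e X -> is_edge e' X.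
Proof.
case/is_edgeP => x [y [EX xy exy]]; apply/is_edgeP; exists x, y; split=> //.
by apply: ee'; rewrite // EX !inE eqxx ?orbT.
Qed.

Lemma is_T3_sub : is_T3 e X -> is_T3 e' X.
Proof.
case/is_T3P => x [y [z [EX xyz exy exz eyz]]]; apply/is_T3P; exists x, y, z.
by split=> //; apply: ee'; rewrite // EX !inE eqxx ?orbT.
Qed.

End Transfer.

Section Universal.

Variables (V : finType) (e : rel V).

Definition universal (U : {set V}) : rel V :=
  fun x y => (x != y) && [|| e x y, x \in U | y \in U].

Lemma universal_irr (U : {set V}) : irreflexive (universal U).
Proof. by move=> x; rewrite /universal eqxx. Qed.

Lemma universal_packable m (U D : {set V}) :
  #|D| = 3 * m -> D \subset U -> packable (universal U) D.
Proof.
elim: m D => [|m IHm] D cD sDU.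
  by move/eqP: cD; rewrite cards_eq0 => /eqP->; apply: packable0.
have /card_gt2P[x [y [z [[xD yD zD] [xy yz zx]]]]] : 2 < #|D| by rewrite cD; lia.
pose T := [set x; y; z].
have T3 : is_T3 (universal U) T.
  apply/is_T3P; exists x, y, z.
  rewrite /universal eq_sym in zx.
  by rewrite /universal xy yz zx !(subsetP sDU _ xD) !(subsetP sDU _ yD) !orbT.
have sTD : T \subset D by rewrite !subUset !sub1set xD yD.
rewrite -(setUDK sTD); apply: packableU1 => //.
  by rewrite disjoint_sym disjoints_subset; apply/subsetP => t; rewrite !inE => /andP[].
apply: IHm; last by apply: subset_trans sDU; apply: subsetDl.
by rewrite cardsD (setIidPr sTD) cD (card_T3 T3); lia.
Qed.

End Universal.

(** [U] shrinks from a set containing [D] to the empty set. Taking [x] out of [U] changes only edges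
    at [x], so it spoils at most the class containing [x], and this class minus [x] remains an
    edge. *)
Lemma min_outdegree_packable (V : finType) m (e : rel V) (D : {set V}) :
  irreflexive e -> #|D| = 3 * m ->
  (forall y, y \in D -> 2 * m <= #|out e y :&: D|) -> packable e D.
Proof.
elim/ltn_ind: m e D => m IH e D e_irr cD degD.
suff [P pP P3] : packable (universal e set0) D.
  exists P => // T /P3; apply: is_T3_sub => x y _ _.
  by rewrite /universal !inE !orbF => /andP[].
suff all_U n (U : {set V}) : #|D :\: U| <= n -> packable (universal e U) D.
  exact: all_U (leqnn _).
elim: n U => [|n IHn] U cU.
  apply: (universal_packable e cD).
  by move: cU; rewrite leqn0 cards_eq0 setD_eq0.
have [sDU|/subsetPn[x xD xU]] := boolP (D \subset U).
  exact: (universal_packable e cD sDU).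
have [P pP P3] : packable (universal e (x |: U)) D.
  apply: IHn; rewrite -ltnS; apply: leq_trans cU; apply: proper_card.
  apply/properP; split; first by rewrite setDS // subsetUr.
  by exists x; rewrite !inE ?eqxx ?xU.
have same (X : {set V}) : x \notin X -> forall u v, u \in X -> v \in X ->
    universal e (x |: U) u v -> universal e U u v.
  move=> xX u v uX vX; rewrite /universal !in_setU1.
  have nx w : w \in X -> (w == x) = false by apply: contraTF => /eqP->.
  by rewrite !nx.
have : x \in cover P by rewrite (cover_partition pP).
case/bigcupP => C CP xC; have C3 := P3 C CP.
have E2 : is_edge (universal e U) (C :\ x).
  by apply: is_edge_sub (T3_edge C3 xC); apply: same; rewrite !inE eqxx.
have sCD := partitionS pP CP.
apply: (@pack_of_near_packing _ _ (universal_irr e U) m D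
  (C :\ x |: P :\ C) (C :\ x) x) => //.
- move=> k S km cS degS; exact: IH (universal_irr e U) cS degS.
- move=> y yD; apply: leq_trans (degD y yD) _; apply: subset_leq_card.
  apply/subsetP => t; rewrite !inE => /andP[yt ->]; rewrite andbT /universal yt andbT.
  exact: out_neq yt.
- split=> //; last 1 first.
  + move=> T; rewrite in_setU1 in_setD1 => /orP[/eqP->|/andP[TC TP] _].
      by rewrite eqxx.
    apply: is_T3_sub (P3 T TP); apply: same; apply: contraNN TC => xT; apply/eqP.
    have /and3P[_ tP _] := pP.
    by rewrite -(def_pblock tP TP xT) (def_pblock tP CP xC).
  + have -> : D :\ x = (C :\ x) :|: (D :\: C).
      apply/setP => t; rewrite !inE; have [->|tx] /= := eqVneq t x; first by rewrite xC.
      by have [/(subsetP sCD)->|] := boolP (t \in C).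
    apply: partitionU1; first exact: partitionD1.
      by rewrite -card_gt0 (card_edge E2).
    by rewrite disjoints_subset; apply/subsetP => t; rewrite !inE => /andP[_ ->].
  + exact: setU11.
Qed.

(** * From partitions into vertex sets to families of embeddings *)

Lemma T3_copy_of_is_T3 (V : finType) (e : rel V) (T : {set V}) :
  irreflexive e -> is_T3 e T ->
  exists2 f : {ffun 'I_3 -> V}, T3_copy e f & codom f =i T.
Proof.
move=> e_irr /is_T3P[x [y [z [-> _ exy exz eyz]]]].
pose f := [ffun i : 'I_3 => nth x [:: x; y; z] i].
have hom (i j : 'I_3) : T3 i j -> e (f i) (f j).
  by rewrite /T3 !ffunE; case: i j => [[|[|[|?]]] ?] [[|[|[|?]]] ?].
exists f; first split=> // i j fij.
  apply: val_inj; have [ij|ij|//] := ltngtP i j.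
    by have := hom i j ij; rewrite fij e_irr.
  by have := hom j i ij; rewrite fij e_irr.
move=> t; rewrite !inE -orbA; apply/codomP/or3P => [[[[|[|[|//]]] ?]]|].
- by rewrite ffunE => ->; constructor 1.
- by rewrite ffunE => ->; constructor 2.
- by rewrite ffunE => ->; constructor 3.
case=> /eqP->; [exists (@Ordinal 3 0 isT)|exists (@Ordinal 3 1 isT)
  |exists (@Ordinal 3 2 isT)]; by rewrite ffunE.
Qed.

Lemma perfect_of_packable (V : finType) (e : rel V) : irreflexive e ->
  packable e [set: V] -> exists P, perfect_T3_packing e P.
Proof.
move=> e_irr [P pP P3]; have /and3P[_ /trivIsetP tP _] := pP.
have copyP (f : {ffun 'I_3 -> V}) : reflect (T3_copy e f)
    (injectiveb f && [forall i, forall j, T3 i j ==> e (f i) (f j)]).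
  apply: (iffP andP) => -[/injectiveP inj hom]; split=> //; last first.
    by apply/forallP => i; apply/forallP => j; apply/implyP/hom.
  by move=> i j; move/forallP/(_ i)/forallP/(_ j)/implyP: hom; apply.
(* [g T] is a chosen copy with vertex set [T]; on classes of [P] it is never [None]. *)
pose g T := [pick f : {ffun 'I_3 -> V} | [set t in codom f] == T &
  injectiveb f && [forall i, forall j, T3 i j ==> e (f i) (f j)]].
exists [set f | Some f \in g @: P].
have inP f : f \in [set f | Some f \in g @: P] ->
    exists T, [/\ T \in P, g T = Some f, T3_copy e f & codom f =i T].
  rewrite inE => /imsetP[T TP /esym gT].
  have [cf fT] : T3_copy e f /\ [set t in codom f] = T.
    by move: gT; rewrite /g; case: pickP => // f' /andP[/eqP fT /copyP cf] [<-].
  by exists T; split=> // t; rewrite -fT inE.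
split; first split.
- by move=> f /inP[T [_ _ ? _]].
- move=> f f' /inP[T [TP gT _ fT]] /inP[T' [TP' gT' _ fT']] ff'.
  rewrite (eq_disjoint fT) disjoint_sym (eq_disjoint fT') disjoint_sym; apply: tP => //.
  by apply: contraNneq ff' => TT; apply/eqP; apply: Some_inj; rewrite -gT -gT' TT.
move=> x; have : x \in cover P by rewrite (cover_partition pP) inE.
case/bigcupP => T TP xT.
have [f cf fT] := T3_copy_of_is_T3 e_irr (P3 T TP).
case gT : (g T) => [h|]; last first.
  move: gT; rewrite /g; case: pickP => // /(_ f) /negP[]; apply/andP; split; last exact/copyP.
  by apply/eqP/setP => t; rewrite inE fT.
have hP : h \in [set f | Some f \in g @: P] by rewrite inE -gT imset_f.
exists h => //; move: gT; rewrite /g; case: pickP => // h' /andP[/eqP h'T _] [<-].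
by rewrite -h'T inE in xT.
Qed.

(* Reversing the edges at vertices of large indegree makes every outdegree
   large; between the two kinds of vertices only the edges from the first kind
   to the second survive, doubled, so a triple meeting both kinds is transitive
   in [e] as soon as its vertices are pairwise adjacent. *)
Lemma is_T3_reverse (V : finType) (e : rel V) (A : pred V) (T : {set V}) :
  irreflexive e -> is_T3 (fun x y => if A x then e x y else e y x) T -> is_T3 e T.
Proof.
move=> e_irr /is_T3P[x [y [z [-> _]]]].
have T3I (u v w : V) : e u v -> e u w -> e v w -> [set x; y; z] =i [set u; v; w] ->
    is_T3 e [set x; y; z].
  move=> euv euw evw /setP->; apply/is_T3P; exists u, v, w; split=> //.
  by rewrite !(out_neq e_irr).
case: (A x); case: (A y) => exy exz eyz.
- exact: (T3I x y z).
- by apply: (T3I x z y) => // t; rewrite !inE orbAC.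
- by apply: (T3I y z x) => // t; rewrite !inE -orbA orbC.
- by apply: (T3I z y x) => // t; rewrite !inE orbC (orbC (t == x)) orbA.
Qed.

(* The degree bound d >= 2n/3, with n = #|V|, is written 2n <= 3d. *)
Theorem theorem4p1 (m : nat) (V : finType) (e : rel V)
    (e_irr : irreflexive e) (card_V : #|V| = 3 * m)
    (deg_e : forall x : V,
       2 * #|V| <= 3 * outdeg e x \/ 2 * #|V| <= 3 * indeg e x) :
  exists P : {set {ffun 'I_3 -> V}}, perfect_T3_packing e P.
Proof.
pose big x := 2 * #|V| <= 3 * outdeg e x.
pose e' x y := if big x then e x y else e y x.
have e'_irr : irreflexive e' by move=> x; rewrite /e' e_irr if_same.
apply: (perfect_of_packable e_irr).
suff [P pP P3] : packable e' [set: V].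
  by exists P => // T /P3; apply: is_T3_reverse.
apply: (@min_outdegree_packable _ m) => // [|x _]; first by rewrite cardsT.
suff : 2 * #|V| <= 3 * #|out e' x| by rewrite setIT card_V; clear; lia.
have [bx|nbx] := boolP (big x).
  by rewrite /out /e' bx.
rewrite /out /e' (negPf nbx); case: (deg_e x) => // bx.
by rewrite /big bx in nbx.
Qed.
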